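(* Game II.1 (the no-information, non-constant-sum Showcase Showdown game with unlimited spins) with $n$ players admits a Nash equilibrium in which all players use the same threshold $\alpha_n$. Moreover, the winning probability of each player in that Nash equilibrium is $$P_n:=\frac{1-\left(1-e^{\alpha_n}+e^{\alpha_n}\alpha_n\right)^n}{n}.$$
   Context: Score of a player using a greed threshold: let $Z_1,Z_2,\dots$ be independent random variables uniformly distributed on $[0,1]$ and $\chi_k=Z_1+\dots+Z_k$. For $\tau\in[0,1]$ let $N=\min\{k\ge1:\chi_k\ge\tau\}$. The score $\xi_\tau$ is $\chi_N$ if $\chi_N\le1$ and $0$ if $\chi_N>1$. Game II.1: there are $n$ players. Player $i$ chooses a threshold $\kappa_i\in[0,1]$ with no information about the other players, and obtains the score $\xi^{(i)}_{\kappa_i}$, where the scores of different players are independent and $\xi^{(i)}_{\kappa_i}$ is distributed as $\xi_{\kappa_i}$. The winner is the player with the greatest score; if all scores are $0$ there is no winner. The winner receives a payoff of $1$ from an external agent and everybody else receives $0$; if all scores are $0$, every player's payoff is $0$. Thus the expected payoff of a player is his probability of winning. A Nash equilibrium is a profile $(\kappa_1,\dots,\kappa_n)$ such that no player can increase his expected payoff by unilaterally changing his own threshold. For each integer $n\ge1$, $\alpha_n$ denotes the unique solution $x\in[0,1)$ of $$\left(1+e^{x}(x-1)\right)^{n-1}=\frac{1-\left(1+e^{x}(x-1)\right)^n}{ne^{x}}$$ (with the convention $0^0=1$; $\alpha_1=0$ and $\alpha_n\in(0,1)$ for $n\ge2$). *)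

(* Defs.v *)
From HB Require Import structures.
From mathcomp Require Import all_boot all_order all_algebra.
From mathcomp Require Import all_classical all_reals all_analysis.

Set Implicit Arguments.
Unset Strict Implicit.
Unset Printing Implicit Defensive.

Import Order.TTheory GRing.Theory Num.Theory.

Local Open Scope classical_set_scope.
Local Open Scope ring_scope.

(* In a sequence of spins [z : nat -> R], [z j] is the outcome of spin [j + 1]. *)
Definition spin_total (R : realType) (z : nat -> R) (k : nat) : R :=
  \sum_(j < k) z j.

Definition reaches (R : realType) (tau : R) (z : nat -> R) (k : nat) : bool :=
  (0 < k)%N && (tau <= spin_total z k).

(* If the threshold is never reached (a null event for independent uniform
   spins) the score is 0 by convention. *)
Definition score (R : realType) (tau : R) (z : nat -> R) : R :=
  match pselect (exists k, reaches tau z k) with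
  | left ex =>
      let c := spin_total z (ex_minn ex) in if c <= 1 then c else 0
  | right _ => 0
  end.

Definition mutually_independent (d d' : measure_display)
    (T : measurableType d) (S : measurableType d') (R : realType)
    (P : probability T R) (I : eqType) (X : I -> {RV P >-> S}) : Prop :=
  forall (J : seq I) (A : I -> set S), uniq J ->
    (forall j, measurable (A j)) ->
    P (\big[setI/setT]_(j <- J) (X j @^-1` A j)) =
      (\prod_(j <- J) P (X j @^-1` A j))%E.

(* [X] and [Y] may live on different probability spaces. *)
Definition same_law (d1 d2 d' : measure_display)
    (T1 : measurableType d1) (T2 : measurableType d2) (S : measurableType d')
    (R : realType) (P1 : probability T1 R) (P2 : probability T2 R)
    (X : T1 -> S) (Y : T2 -> S) : Prop :=
  forall A : set S, measurable A -> pushforward P1 X A = pushforward P2 Y A.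

Definition uniform01 (d : measure_display) (T : measurableType d)
    (R : realType) (P : probability T R) (X : {RV P >-> R}) : Prop :=
  forall A : set R, measurable A ->
    distribution P X A = uniform_prob (@ltr01 R) A.

(* A tie at a positive score (a null event under independent scores of the
   players) has no winner. *)
Definition wins (R : realType) (n : nat) (s : 'I_n -> R) (i : 'I_n) : bool :=
  (0 < s i) && [forall j, (j != i) ==> (s j < s i)].

Definition payoff (R : realType) (n : nat) (s : 'I_n -> R) (i : 'I_n) : R :=
  (wins s i)%:R.

(* [xi j tau] is the score of player [j] when using the threshold [tau]. *)
Definition expected_payoff (d : measure_display) (T : measurableType d)
    (R : realType) (P : probability T R) (n : nat)
    (xi : 'I_n -> R -> {RV P >-> R}) (kappa : 'I_n -> R) (i : 'I_n) : \bar R :=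
  'E_P[fun w => payoff (fun j => xi j (kappa j) w) i]%E.

Definition winning_probability (d : measure_display) (T : measurableType d)
    (R : realType) (P : probability T R) (n : nat)
    (xi : 'I_n -> R -> {RV P >-> R}) (kappa : 'I_n -> R) (i : 'I_n) : \bar R :=
  P [set w | wins (fun j => xi j (kappa j) w) i].

Definition deviate (I : eqType) (A : Type) (kappa : I -> A) (i : I) (x : A) :
    I -> A :=
  fun j => if j == i then x else kappa j.

Definition nash_equilibrium (R : realType) (I : eqType) (A : Type)
    (S : set A) (u : (I -> A) -> I -> \bar R) (kappa : I -> A) : Prop :=
  (forall i, S (kappa i)) /\
  (forall (i : I) (x : A), S x -> (u (deviate kappa i x) i <= u kappa i)%E).

(* For [n = 1] and [x = 0] the left-hand side is [0 ^+ 0 = 1]. *)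
Definition threshold_equation (R : realType) (n : nat) (x : R) : Prop :=
  0 <= x < 1 /\
  (1 + expR x * (x - 1)) ^+ n.-1 =
    (1 - (1 + expR x * (x - 1)) ^+ n) / (n%:R * expR x).

(* Main.v *)
(* The sums of k uniform spins reach a point s of [0, 1] with density
   s^(k-1)/(k-1)!, so P(Z_1 + ... + Z_k < tau) = tau^k/k!, and the score jumps
   from below tau <= 1 into ]m, 1], with tau <= m, with probability
   (1 - m) tau^k/k! at spin k + 1.  Summing over k, the score has density e^tau
   on [tau, 1].  If h(t) is the probability that all rivals, playing a, score
   less than t, then the threshold tau wins with probability
   W(tau) = e^tau * int_tau^1 h.  Writing F(a) = 1 + e^a (a - 1), the equation
   for a says c := int_a^1 h = h(a) = F(a)^(n-1).  As h >= c on [a, 1] and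
   h = c on ]0, a], we get int_tau^1 h <= c (1 + (a - tau)) <= c e^(a - tau),
   that is W(tau) <= W(a). *)
Require Import Defs.
From HB Require Import structures.
From mathcomp Require Import all_boot all_order all_algebra.
From mathcomp Require Import ring lra.
From mathcomp Require Import all_classical all_reals all_analysis.
From mathcomp Require Import measurable_realfun.

Set Implicit Arguments.
Unset Strict Implicit.
Unset Printing Implicit Defensive.

Import Order.TTheory GRing.Theory Num.Theory.
Import numFieldNormedType.Exports.

Local Open Scope classical_set_scope.
Local Open Scope ring_scope.

(** * Iterated integration order, and measures of almost surely equal events *)

Lemma product_measure12E (R : realType) d1 d2 (T1 : measurableType d1)
    (T2 : measurableType d2) (m1 : {sigma_finite_measure set T1 -> \bar R})
    (m2 : {sigma_finite_measure set T2 -> \bar R}) C :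
  measurable C -> (m1 \x m2)%E C = (m1 \x^ m2)%E C.
Proof.
by move=> mC; apply: product_measure_unique => //= *; rewrite product_measure2E.
Qed.

Lemma eq_measure_ae (R : realType) d (T : measurableType d)
    (P : {measure set T -> \bar R}) (A B : set T) :
  measurable A -> measurable B ->
  {ae P, forall w, A w <-> B w} -> P A = P B.
Proof.
move=> mA mB AB; rewrite -[A]setIT -[B]setIT -!integral_indic//.
apply: ae_eq_integral => //; [exact/measurable_EFinP|exact/measurable_EFinP|].
apply: filterS AB => w AB _; rewrite !indicE.
by rewrite (_ : (w \in A) = (w \in B))//; apply/idP/idP; rewrite !inE => /AB.
Qed.

(** * Independence of a fold of some variables from the remaining ones *)

Section independence.
Context (R : realType) d (T : measurableType d) (P : probability T R).

(** Both sides are finite measures in [C] that agree on rectangles, so uniqueness of product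
    measures applies. The extra event [E] carries the untouched variables through the induction of
    [big_op_indep]. *)
Lemma product_law_setI {d1 d2} {S1 : measurableType d1}
    {S2 : measurableType d2} (X : {mfun T >-> S1}) (Y : {mfun T >-> S2})
    (E : set T) : measurable E ->
  (forall A B, measurable A -> measurable B ->
    P (X @^-1` A `&` (Y @^-1` B `&` E)) =
      (P (X @^-1` A) * (P (Y @^-1` B) * P E))%E) ->
  forall C, measurable C ->
    P ([set w | C (X w, Y w)] `&` E) =
      ((distribution P X \x distribution P Y) C * P E)%E.
Proof.
move=> mE XYE C mC.
pose k := NngNum (fine_ge0 (measure_ge0 P E)).
have kE : k%:num%:E = P E by rewrite /= fineK// fin_num_measure.
have mXY : measurable_fun setT (fun w => (X w, Y w)).
  by apply/measurable_fun_pairP.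
have := @product_measure_unique _ _ _ _ R (distribution P X)
  (mscale k (distribution P Y))
  (pushforward (mrestr P mE) (mfun_Sub (mem_set mXY))) _ C mC.
move=> XY.
have -> : P ([set w | C (X w, Y w)] `&` E) =
    (distribution P X \x mscale k (distribution P Y))%E C.
  rewrite XY// => A B mA mB.
  transitivity (P (X @^-1` A `&` (Y @^-1` B `&` E))); first by rewrite setIA.
  have e1 : P (X @^-1` A) = distribution P X A by [].
  have e2 : (P E * P (Y @^-1` B) = k%:num%:E * distribution P Y B)%E
    by rewrite kE.
  rewrite XYE// [(P (Y @^-1` B) * _)%E]muleC e1 e2; reflexivity.
rewrite muleC -kE /product_measure1 -ge0_integralZl//=.
- exact: measurable_fun_xsection.
- by rewrite lee_fin fine_ge0.
Qed.

Context (I : eqType) (X : I -> {RV P >-> R}) (op : R -> R -> R) (idx : R).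
Hypothesis mop : measurable_fun setT (fun xy : R * R => op xy.1 xy.2).
Hypothesis X_indep : mutually_independent X.

Lemma measurable_big_op (J : seq I) :
  measurable_fun setT (fun w => \big[op/idx]_(j <- J) X j w).
Proof.
elim: J => [|j J mJ].
  by under eq_fun do rewrite big_nil; exact: measurable_cst.
under eq_fun do rewrite big_cons.
apply: (measurableT_comp mop (_ : measurable_fun setT
  (fun w => (X j w, \big[op/idx]_(j <- J) X j w)))).
by apply/measurable_fun_pairP; split => //=; exact: measurable_funPT.
Qed.

Let mX j B : measurable B -> measurable (X j @^-1` B).
Proof. by move=> mB; exact: measurable_funPTI. Qed.

(** Induction on [J], moving its head [j] over to [K]: the induction hypothesis for [j :: K] gives
    the product rule on rectangles for [X j] and the fold of the tail, and [product_law_setI]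
    extends it to the set of pairs that [op] sends into [A]. *)
Lemma big_op_indep (J K : seq I) (A : set R) (B : I -> set R) :
  uniq (J ++ K) -> measurable A -> (forall j, measurable (B j)) ->
  P ([set w | A (\big[op/idx]_(j <- J) X j w)] `&`
     \big[setI/setT]_(k <- K) (X k @^-1` B k)) =
  (P [set w | A (\big[op/idx]_(j <- J) X j w)] *
     \prod_(k <- K) P (X k @^-1` B k))%E.
Proof.
elim: J K A B => [|j J IH] K A B uJK mA mB.
  have [Ai|Ai] := pselect (A idx).
    rewrite (_ : [set w | A _] = setT).
      by rewrite setTI probability_setT mul1e X_indep.
    by apply/seteqP; split => // w _ /=; rewrite big_nil.
  rewrite (_ : [set w | A _] = set0).
    by rewrite set0I measure0 mul0e.
  by apply/seteqP; split => // w /=; rewrite big_nil.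
pose Y : {mfun T >-> R} := mfun_Sub (mem_set (measurable_big_op J)).
pose C := [set xy : R * R | A (op xy.1 xy.2)].
have mC : measurable C.
  by rewrite /C -[X in measurable X]setTI; exact: mop.
have uj : uniq (J ++ [:: j]).
  by move: uJK; rewrite /= cats1 rcons_uniq mem_cat cat_uniq;
    case/andP => /norP[-> _] /and3P[].
have ujK : uniq (J ++ j :: K) by rewrite -cat1s uniq_catCA.
have CE w : A (\big[op/idx]_(j <- j :: J) X j w) = C (X j w, Y w).
  by rewrite big_cons.
under eq_set do rewrite CE.
pose E := \big[setI/setT]_(k <- K) (X k @^-1` B k).
have mE : measurable E by apply: bigsetI_measurable => k _; exact: mX.
have uK : uniq K by move: uJK; rewrite cat_uniq => /and3P[].
have XYE A' B' : measurable A' -> measurable B' ->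
    P (X j @^-1` A' `&` (Y @^-1` B' `&` E)) =
    (P (X j @^-1` A') * (P (Y @^-1` B') * P E))%E.
  move=> mA' mB'.
  (* [j] does not occur in [K], so changing [B] at [j] leaves the events of [K] alone. *)
  pose B1 i := if i == j then A' else B i.
  have B1E k : k \in K -> B1 k = B k.
    move=> kK; rewrite /B1; case: eqP => // kj; move: uJK.
    by rewrite -kj /= mem_cat kK orbT.
  have /(IH _ _ _ ujK mB') : forall k, measurable (B1 k).
    by move=> k; rewrite /B1; case: ifP.
  rewrite !big_cons {1 3}/B1 eqxx.
  rewrite (eq_big_seq (fun k => X k @^-1` B k)); last by move=> k /B1E ->.
  rewrite [in X in _ = X -> _](eq_big_seq (fun k => P (X k @^-1` B k)));
    last by move=> k /B1E ->.
  by rewrite -X_indep// => {}IH; rewrite setICA muleCA; exact: IH.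
have XY A' B' : measurable A' -> measurable B' ->
    P (X j @^-1` A' `&` (Y @^-1` B' `&` setT)) =
    (P (X j @^-1` A') * (P (Y @^-1` B') * P setT))%E.
  move=> mA' mB'.
  rewrite setIT probability_setT mule1 setIC muleC.
  by have := IH [:: j] B' (fun=> A') uj mB' (fun=> mA'); rewrite !big_seq1.
rewrite -X_indep// (product_law_setI mE XYE)//.
have := product_law_setI measurableT XY mC.
by rewrite setIT probability_setT mule1 => ->.
Qed.

Lemma big_op_product_law (j : I) (J : seq I) (Y : {mfun T >-> R})
    (C : set (R * R)) :
  uniq (j :: J) -> (forall w, Y w = \big[op/idx]_(j <- J) X j w) ->
  measurable C ->
  P [set w | C (Y w, X j w)] = (distribution P Y \x distribution P (X j))%E C.
Proof.
move=> ujJ YE mC.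
have := @product_law_setI _ _ _ _ Y (X j) setT measurableT.
move=> /(_ _ C mC); rewrite setIT probability_setT mule1; apply => A B mA mB.
rewrite setIT mule1.
have -> : Y @^-1` A = [set w | A (\big[op/idx]_(j <- J) X j w)].
  by apply/seteqP; split => w /=; rewrite YE.
have := @big_op_indep J [:: j] A (fun=> B); rewrite !big_seq1; apply => //.
by rewrite cats1 rcons_uniq.
Qed.

End independence.

(** * Uniform spins and their totals *)

Section uniform_spins.
Context {R : realType}.
Notation mu := (@lebesgue_measure R).

Lemma integral_deriv_poly (p : {poly R}) (a b : R) : a <= b ->
  (\int[mu]_(x in `[a, b]) (deriv p).[x]%:E = (p.[b] - p.[a])%:E)%E.
Proof.
rewrite le_eqVlt => /predU1P[->|ab].
  by rewrite set_itv1 integral_set1 subrr.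
rewrite (@continuous_FTC2 _ _ (horner p))//.
- by apply: continuous_subspaceT => x; exact: continuous_horner.
- split => [x _||]; first exact: ex_derive.
  + by apply: cvg_at_right_filter; exact: continuous_horner.
  + by apply: cvg_at_left_filter; exact: continuous_horner.
- by move=> x _; rewrite derive1E; apply: derive_val.
Qed.

Lemma integral_affine_exp (c d a b : R) (k : nat) : c != 0 -> a <= b ->
  (\int[mu]_(x in `[a, b]) ((c * x + d) ^+ k)%:E =
   (((c * b + d) ^+ k.+1 - (c * a + d) ^+ k.+1) / (c * k.+1%:R))%:E)%E.
Proof.
move=> c0 ab; have ck0 : c * k.+1%:R != 0 by rewrite mulf_neq0 ?pnatr_eq0.
pose p : {poly R} := (c * k.+1%:R)^-1 *: (c *: 'X + d%:P) ^+ k.+1.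
have pE x : p.[x] = (c * x + d) ^+ k.+1 / (c * k.+1%:R).
  by rewrite /p !hornerE mulrC.
have dpE x : (deriv p).[x] = (c * x + d) ^+ k.
  rewrite /p derivZ deriv_exp !poly.derivE addr0/= alg_polyC hornerZ.
  rewrite hornerMn !hornerE -[X in _ * X]mulr_natr; field.
  by rewrite c0/= addrC natr1 pnatr_eq0.
under eq_integral do rewrite -dpE.
by rewrite integral_deriv_poly// !pE -mulrBl.
Qed.

Lemma uniform_prob01E (A : set R) : measurable A ->
  uniform_prob (@ltr01 R) A = mu (A `&` `[0, 1]).
Proof.
move=> mA; rewrite /uniform_prob integral_uniform_pdf.
rewrite (eq_integral (fun=> 1%E)); last first.
  move=> x; rewrite inE/= in_itv/= /uniform_pdf => -[_ ->].
  by rewrite subr0 invr1.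
by rewrite integral_cst ?mul1e//; exact: measurableI.
Qed.

Lemma uniform_prob01_itv (b0 b1 : bool) (a b : R) : 0 <= a -> b <= 1 ->
  uniform_prob (@ltr01 R) [set` Interval (BSide b0 a) (BSide b1 b)] =
  (Num.max (b - a) 0)%:E.
Proof.
move=> a0 b1'; rewrite uniform_prob01E// setIidl; last first.
  move=> x /=; rewrite !in_itv/= => /andP[/lteifW ax /lteifW xb].
  by rewrite (le_trans a0 ax) (le_trans xb b1').
rewrite lebesgue_measure_itv/= lte_fin.
case: ltP => ab.
  by rewrite -EFinB; congr (_%:E); apply/esym/max_l; rewrite subr_ge0 ltW.
by congr (_%:E); apply/esym/max_r; rewrite subr_le0.
Qed.

Context {d} {T : measurableType d} {P : probability T R}.
Variable Z : nat -> {RV P >-> R}.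
Hypothesis Z_unif : forall k, uniform01 (Z k).
Hypothesis Z_indep : mutually_independent Z.

(** Only the law of a spin is given, so its sign is known only almost surely; later comparisons of
    events that rely on monotone totals go through this null set. *)
Lemma spins_ge0 : {ae P, forall w, forall k, 0 <= Z k w}.
Proof.
apply: ae_foralln => k.
have mN : measurable (Z k @^-1` `]-oo, 0[) by exact: measurable_funPTI.
exists (Z k @^-1` `]-oo, 0[); split => //; last first.
  by move=> w /=; rewrite in_itv/= ltNge => /negP.
transitivity (distribution P (Z k) `]-oo, 0[) => //.
rewrite Z_unif// uniform_prob01E// (_ : _ `&` _ = set0) ?measure0//.
rewrite -subset0 => x /= []; rewrite !in_itv/= => x0 /andP[+ _].
by rewrite leNgt x0.
Qed.

Lemma spin_totalE k w :
  spin_total (Z ^~ w) k = \big[+%R/0]_(j <- iota 0 k) Z j w.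
Proof.
by rewrite /spin_total -(big_mkord xpredT (Z ^~ w)) /index_iota subn0.
Qed.

Let madd : measurable_fun setT (fun xy : R * R => xy.1 + xy.2).
Proof. exact: measurable_funD. Qed.

Lemma measurable_spin_total k :
  measurable_fun setT (fun w => spin_total (Z ^~ w) k).
Proof.
under eq_fun do rewrite spin_totalE.
exact: measurable_big_op.
Qed.

Definition spin_total_mfun k : {mfun T >-> R} :=
  mfun_Sub (mem_set (measurable_spin_total k)).

(** Counting starts at 0, so [Z k] is the spin that follows the first [k] and is independent of
    their total. *)
Lemma spin_total_law k (C : set (R * R)) : measurable C ->
  P [set w | C (spin_total (Z ^~ w) k, Z k w)] =
  (distribution P (spin_total_mfun k) \x uniform_prob (@ltr01 R))%E C.
Proof.
move=> mC.
have := @big_op_product_law _ _ _ _ _ _ _ 0 madd Z_indep k (iota 0 k)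
  (spin_total_mfun k) C.
move=> /= -> //.
- rewrite /product_measure1; apply: eq_integral => x _ /=.
  by rewrite -(Z_unif k)//; exact: measurable_xsection.
- by rewrite iota_uniq mem_iota/= ltnn.
- by move=> w; rewrite -spin_totalE.
Qed.

End uniform_spins.

(** * Monotonicity and distribution of the spin totals *)

Lemma spin_totalS (R : realType) (z : nat -> R) k :
  spin_total z k.+1 = spin_total z k + z k.
Proof. by rewrite /spin_total big_ord_recr. Qed.

Lemma spin_total_nd (R : realType) (z : nat -> R) : (forall k, 0 <= z k) ->
  {homo spin_total z : i j / (i <= j)%N >-> i <= j}.
Proof.
move=> z0; apply: homo_leq => // [x y w|k]; first exact: le_trans.
by rewrite spin_totalS lerDl.
Qed.

Section spins.
Context {R : realType} {d} {T : measurableType d} {P : probability T R}.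
Variable Z : nat -> {RV P >-> R}.
Hypothesis Z_unif : forall k, uniform01 (Z k).
Hypothesis Z_indep : mutually_independent Z.

Notation mu := (@lebesgue_measure R).
Notation S k w := (spin_total (Z ^~ w) k).

Lemma measurable_spin_total_preimage k (A : set R) :
  measurable A -> measurable [set w | A (S k w)].
Proof.
move=> mA; rewrite -[X in measurable X]setTI.
exact: (measurable_spin_total Z k measurableT mA).
Qed.

Lemma measurable_spin_total_lt k t : measurable [set w | S k w < t].
Proof.
have := measurable_spin_total_preimage k (measurable_itv `]-oo, t[).
by rewrite [X in measurable X](_ : _ = [set w | S k w < t]).
Qed.

Lemma spin_total_lt0 k t : t <= 0 -> P [set w | S k w < t] = 0.
Proof.
move=> t0; rewrite -(measure0 P); apply: eq_measure_ae => //.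
  exact: measurable_spin_total_lt.
apply: filterS (spins_ge0 Z_unif) => w Z0; split => //=; apply/negP.
rewrite -leNgt (le_trans t0)//.
by have := spin_total_nd Z0 (leq0n k); rewrite {1}/spin_total big_ord0.
Qed.

(** Conditioning on the last spin y turns the induction step into the integral of (t - y)^k / k!
    over 0 <= y < t, and t <= 1 keeps this range inside [0, 1]. The value t = 0 is excluded because
    for k = 0 the formula would give 1 for an impossible event. *)
Lemma spin_total_lt k t : 0 < t <= 1 ->
  P [set w | S k w < t] = (t ^+ k / k`!%:R)%:E.
Proof.
elim: k t => [|k IH] t /andP[t0 t1].
  rewrite (_ : [set w | _] = setT) ?probability_setT ?expr0 ?divr1//.
  by apply/seteqP; split => w //= _; rewrite /spin_total big_ord0.
pose C := [set xy : R * R | xy.1 + xy.2 < t].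
have mC : measurable C.
  have madd : measurable_fun setT (fun xy : R * R => xy.1 + xy.2).
    exact: measurable_funD.
  have := madd measurableT _ (measurable_itv `]-oo, t[).
  rewrite setTI (_ : _ @^-1` _ = C)//.
under eq_set do rewrite spin_totalS.
rewrite (spin_total_law Z_unif Z_indep k mC) product_measure12E//.
rewrite /product_measure2 integral_uniform//; last first.
  exact: measurable_fun_ysection.
rewrite subr0 invr1 mul1e.
(* The section at y is the event that the first k spins total less than t - y; it is null for y >=
   t, whence the restriction to [0, t[. *)
transitivity (\int[mu]_(y in `[0%R, 1%R])
    ((fun y => ((-1 * y + t) ^+ k / k`!%:R)%:E) \_ `[0%R, t[) y)%E.
  apply: eq_integral => y; rewrite inE/= in_itv/= => /andP[y0 y1].
  rewrite /distribution /pushforward/=.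
  rewrite (_ : _ @^-1` _ = [set w | S k w < t - y]); last first.
    apply/seteqP; split => w /=; rewrite /ysection/= inE /C/=;
      by rewrite ltrBrDr.
  rewrite patchE mem_setE in_itv/= y0/=; case: ltP => yt.
    rewrite IH; last by rewrite subr_gt0 yt lerBlDr (le_trans t1)// lerDl.
    by rewrite mulN1r addrC.
  by rewrite spin_total_lt0// subr_le0.
rewrite -integral_mkcondr (_ : _ `&` _ = `[0, t[%classic); last first.
  apply/seteqP; split => y /=; rewrite !in_itv/=; first by case=> /andP[-> _].
  by move=> /andP[-> yt]; rewrite (le_trans (ltW yt)).
have mF : measurable_fun setT (fun y : R => (-1 * y + t) ^+ k).
  apply: measurable_funX; apply: measurable_funD => //.
rewrite integral_itv_bndo_bndc; last first.
  apply/measurable_EFinP; apply: measurable_funTS.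
  exact: measurable_funM.
under eq_integral do rewrite EFinM.
rewrite ge0_integralZr//; last 2 first.
- by apply/measurable_EFinP; apply: measurable_funTS.
- move=> y /=; rewrite in_itv/= => /andP[_ yt].
  by rewrite lee_fin exprn_ge0// mulN1r addrC subr_ge0.
rewrite integral_affine_exp ?ltW// ?oppr_eq0 ?oner_eq0//.
rewrite mulr0 !add0r mulN1r addNr expr0n/= sub0r -EFinM factS natrM.
by congr (_%:E); rewrite mulN1r invrN mulrNN invfM mulrA.
Qed.

End spins.

(** * Law of the score on intervals ending at 1 *)

Section score_law.
Context {R : realType} {d} {T : measurableType d} {P : probability T R}.
Variable Z : nat -> {RV P >-> R}.
Hypothesis Z_unif : forall k, uniform01 (Z k).
Hypothesis Z_indep : mutually_independent Z.
Variables (tau m : R) (b : bool).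
Hypotheses (tau0 : 0 <= tau) (taum : tau <= m) (m1 : m <= 1).

Notation S k w := (spin_total (Z ^~ w) k).
Notation J := [set` Interval (BSide b m) (BRight 1)].

(** From a total x in [0, tau[, the next spin has to fall between m - x and 1 - x. As x < tau <= m
    and x >= 0, this interval lies in [0, 1], and its length 1 - m does not depend on x. The flag
    [b] closes the left end of [J] when true and opens it when false. *)
Lemma prob_next_spin k :
  P ([set w | S k w < tau] `&` [set w | J (S k.+1 w)]) =
  ((1 - m)%:E * P [set w | (S k w < tau)%R])%E.
Proof.
(* The bound [0 <= xy.1] costs only a null event and keeps 1 - x at most 1. *)
pose C := [set xy : R * R | (0 <= xy.1 < tau) /\ J (xy.1 + xy.2)].
have mC : measurable C.
  have mfst : measurable_fun setT (fst : R * R -> R) by [].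
  have madd : measurable_fun setT (fun xy : R * R => xy.1 + xy.2).
    exact: measurable_funD.
  have := measurableI _ _ (mfst measurableT _ (measurable_itv `[0, tau[))
    (madd measurableT _ (measurable_itv (Interval (BSide b m) (BRight 1)))).
  rewrite !setTI; congr (measurable _); apply/seteqP; split => xy;
    by rewrite /C /= in_itv.
have mlt := @measurable_spin_total_lt _ _ _ _ Z k tau.
have mJ : measurable [set w | J (S k.+1 w)].
  exact: measurable_spin_total_preimage.
have mco : measurable [set w | 0 <= S k w < tau].
  have := measurable_spin_total_preimage Z k (measurable_itv `[0, tau[).
  by under eq_set do rewrite /= in_itv.
have S_ge0 w : (forall j, 0 <= Z j w) -> 0 <= S k w.
  move=> Z0; have := spin_total_nd Z0 (leq0n k).
  by rewrite {1}/spin_total big_ord0.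
rewrite (_ : P [set w | S k w < tau] = P [set w | 0 <= S k w < tau]);
    last first.
  apply: eq_measure_ae => //.
  by apply: filterS (spins_ge0 Z_unif) => w /S_ge0 /= ->.
transitivity (P [set w | C (S k w, Z k w)]).
  apply: eq_measure_ae; first exact: measurableI.
    rewrite (_ : [set w | _] =
        [set w | 0 <= S k w < tau] `&` [set w | J (S k.+1 w)]).
      exact: measurableI.
    by apply/seteqP; split => w; rewrite /C/= spin_totalS.
  apply: filterS (spins_ge0 Z_unif) => w /S_ge0 /= S0.
  by rewrite /C/= S0 spin_totalS.
rewrite (spin_total_law Z_unif Z_indep k mC) /product_measure1.
transitivity (\int[distribution P (spin_total_mfun Z k)]_x
    ((1 - m)%:E * (\1_(`[0%R, tau[%classic) x)%:E))%E.
  apply: eq_integral => x _; rewrite indicE mem_setE in_itv/=.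
  case: (boolP (0 <= x < tau)) => [/andP[x0 xt]|xt]; last first.
    rewrite mule0 (_ : xsection C x = set0) ?measure0//.
    rewrite -subset0 => y; rewrite /xsection/= inE => -[/=].
    by rewrite (negbTE xt).
  rewrite mule1.
  rewrite (_ : xsection C x =
      [set` Interval (BSide b (m - x)) (BRight (1 - x))]).
    rewrite uniform_prob01_itv ?subr_ge0 ?(le_trans (ltW xt))//; last first.
      by rewrite lerBlDr lerDl.
    rewrite opprB addrA subrK max_l// subr_ge0.
    by [].
  apply/seteqP; split => y; rewrite /xsection/= inE /C/= !in_itv/= x0 xt/=;
   by rewrite lteifBlDl lerBrDl; first [case|split].
rewrite ge0_integralZl//; last by rewrite lee_fin subr_ge0.
  by rewrite integral_indic// setIT.
exact/measurable_EFinP.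
Qed.

(** The first spin is compulsory, so for k = 0 the condition on the previous total is waived; this
    matches tau^0 = 1 even when tau = 0. *)
Lemma prob_passage k :
  P [set w | ((k == 0)%N || (S k w < tau)) /\ J (S k.+1 w)] =
  ((1 - m) * (tau ^+ k / k`!%:R))%:E.
Proof.
case: k => [|k].
  rewrite expr0 divr1 mulr1.
  transitivity (distribution P (Z 0%N) J).
    congr (P _); apply/seteqP; split => w /=;
      by rewrite spin_totalS /spin_total big_ord0 add0r => // -[].
  rewrite Z_unif// uniform_prob01_itv ?(le_trans tau0)//.
  by rewrite max_l ?subr_ge0.
rewrite EFinM.
transitivity (P ([set w | S k.+1 w < tau] `&` [set w | J (S k.+2 w)])).
  by [].
rewrite prob_next_spin; congr (_ * _)%E.
move: tau0; rewrite le_eqVlt => /predU1P[<-|t0].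
  by rewrite spin_total_lt0// expr0n/= mul0r.
by rewrite spin_total_lt// t0 (le_trans taum).
Qed.

(** A bust and a threshold that is never reached both score 0, which [J] excludes; what remains is
    the total at the first passage, after spin k + 1. *)
Lemma score_itvE (z : nat -> R) : ~~ (0 \in Interval (BSide b m) (BRight 1)) ->
  J (score tau z) <->
  exists k, [/\ tau <= spin_total z k.+1,
    forall j, (j < k)%N -> spin_total z j.+1 < tau & J (spin_total z k.+1)].
Proof.
move=> J0; rewrite /score; case: pselect => [ex|nex]; last first.
  split; first by rewrite /= (negbTE J0).
  by case=> k [tk _ _]; case: nex; exists k.+1.
case: ex_minnP => -[//|N] /andP[_ tN] minN; split.
  move=> /=; case: ifPn => [c1 JN|]; last by rewrite (negbTE J0).
  exists N; split => // j jN; rewrite ltNge; apply/negP => tj.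
  by have := minN j.+1 tj; rewrite ltnNge jN.
case=> k [tk ltk Jk].
have -> : N = k.
  apply/eqP; rewrite eqn_leq -ltnS minN//= leqNgt; apply/negP => Nk.
  by have := ltk _ Nk; rewrite ltNge tN.
by move: (Jk); rewrite /= in_itv/= => /andP[_ ->].
Qed.

(** Splitting by the spin of first passage produces the exponential series at [tau], times 1 - m. *)
Lemma prob_score_itv : ~~ (0 \in Interval (BSide b m) (BRight 1)) ->
  P [set w | J (score tau (Z ^~ w))] = (expR tau * (1 - m))%:E.
Proof.
move=> J0.
pose E k := [set w | tau <= S k.+1 w].
(* [seqDU] removes the earlier passages, so [G k] says that the first passage occurs at spin k + 1
   and lands in [J]. *)
pose G k := seqDU E k `&` [set w | J (S k.+1 w)].
have mE k : measurable (E k).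
  have := measurable_spin_total_preimage Z k.+1 (measurable_itv `[tau, +oo[).
  by under eq_set do rewrite /= in_itv/= andbT.
have mJ k : measurable [set w | J (S k.+1 w)].
  exact: measurable_spin_total_preimage.
have mG k : measurable (G k).
  by apply: measurableI => //; exact: seqDU_measurable.
have EP k w : seqDU E k w <->
    tau <= S k.+1 w /\ forall j, (j < k)%N -> S j.+1 w < tau.
  rewrite /seqDU -bigcup_mkord; split.
    case=> tk nE; split => // j jk; rewrite ltNge; apply/negP => tj.
    by apply: nE; exists j.
  by case=> tk ltk; split => // -[j /= /ltk]; rewrite ltNge => /negP.
have -> : [set w | J (score tau (Z ^~ w))] = \bigcup_k G k.
  apply/seteqP; split => w /=.
    move=> /(score_itvE _ J0)[k [tk ltk Jk]]; exists k => //.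
    by split => //; apply/EP.
  by case=> k _ [/EP[tk ltk] Jk]; apply/(score_itvE _ J0); exists k.
have PG k : P (G k) = ((1 - m) * (tau ^+ k / k`!%:R))%:E.
  rewrite -(prob_passage k); apply: eq_measure_ae => //.
    apply: (@measurableI _ _ [set w | (k == 0)%N || (S k w < tau)]) => //.
      case: k => [|k] /=; last exact: measurable_spin_total_lt.
      by rewrite (_ : [set w | _] = setT)//; apply/seteqP.
    exact: mJ.
  (* Totals are now nondecreasing, so all earlier totals are below [tau] as soon as the last one is,
     and [tau <= m] makes any total in [J] a passage. *)
  apply: filterS (spins_ge0 Z_unif) => w Z0; split.
    case=> /EP[tk ltk] Jk; split => //.
    by case: (k) ltk => [//|k'] ltk; rewrite /= ltk.
  case=> tk Jk; split => //; apply/EP; split.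
    move: Jk; rewrite /= in_itv/= => /andP[/lteifW mk _].
    exact: le_trans mk.
  move=> j jk; move: tk; rewrite gtn_eqF ?(leq_ltn_trans (leq0n j))//=.
  by apply: le_lt_trans; exact: spin_total_nd.
have tG : trivIset setT G.
  by apply: trivIset_setIr; exact: trivIset_seqDU.
have := @measure_sigma_additive _ _ _ P G mG tG.
have <- : (fun n => (\sum_(0 <= k < n) exp_coeff tau k * (1 - m))%:E) =
    (fun n => (\sum_(0 <= k < n) P (G k))%E).
  apply/funext => n; rewrite -sumEFin; apply: eq_bigr => k _.
  by rewrite PG mulrC.
have cvgE : (\sum_(0 <= k < n) exp_coeff tau k * (1 - m))%:E @[n --> \oo] -->
    (expR tau * (1 - m))%:E.
  apply/cvg_EFin; first exact: nearW.
  under eq_fun do rewrite /= -mulr_suml.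
  by apply: cvgMl; exact: is_cvg_series_exp_coeff.
move=> cvgP; exact: (cvg_unique _ cvgP cvgE).
Qed.

End score_law.

(** * Tails of the score, and their transfer to any variable with the same law *)

Lemma score_range (R : realType) (tau : R) (z : nat -> R) :
  score tau z = 0 \/ tau <= score tau z <= 1.
Proof.
rewrite /score; case: pselect => [ex|_]; last by left.
case: ex_minnP => N /andP[_ tN] _ /=.
by case: ifPn => c1; [right; rewrite tN|left].
Qed.

Section score_tails.
Context {R : realType} {d} {T : measurableType d} {P : probability T R}.
Variable Z : nat -> {RV P >-> R}.
Hypothesis Z_unif : forall k, uniform01 (Z k).
Hypothesis Z_indep : mutually_independent Z.
Variable tau : R.
Hypothesis tau01 : 0 <= tau <= 1.

(** No score lies strictly between 0 and [tau], so a smaller [m] may be raised to [tau], with the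
    closed interval [tau, 1]; the outer maximum covers m > 1. *)
Lemma prob_score_gt m : 0 <= m ->
  P [set w | m < score tau (Z ^~ w)] =
  (expR tau * Num.max (1 - Num.max m tau) 0)%:E.
Proof.
have /andP[tau0 tau1] := tau01; move=> m0.
case: (leP m 1) => [m1|m1]; last first.
  rewrite (_ : [set w | _] = set0).
    by rewrite measure0 max_r ?mulr0// subr_le0 le_max ltW.
  rewrite -subset0 => w /=; apply/negP; rewrite -leNgt.
  case: (score_range tau (Z ^~ w)) => [->//|/andP[_ /le_trans]]; apply.
  exact: ltW.
case: (ltP m tau) => [mt|tm].
  rewrite max_l ?subr_ge0//.
  rewrite -(prob_score_itv Z_unif Z_indep (m := tau) (b := true) tau0)//;
    last first.
    by rewrite in_itv/= negb_and -ltNge (le_lt_trans m0).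
  congr (P _); apply/seteqP; split => w /=; rewrite in_itv/=.
    move=> mw; case: (score_range tau (Z ^~ w)) => // s0.
    by move: mw; rewrite s0 ltNge m0.
  by move=> /andP[/(lt_le_trans mt)].
rewrite max_l ?subr_ge0//.
rewrite -(prob_score_itv Z_unif Z_indep (m := m) (b := false) tau0)//;
    last first.
  by rewrite in_itv/= negb_and -leNgt m0.
congr (P _); apply/seteqP; split => w /=; rewrite in_itv/=.
  move=> mw; rewrite mw; case: (score_range tau (Z ^~ w)) => [->|/andP[]//].
  exact: ler01.
by case/andP.
Qed.

Lemma prob_score_ge t : 0 < t <= 1 ->
  P [set w | t <= score tau (Z ^~ w)] =
  (expR tau * (1 - Num.max t tau))%:E.
Proof.
have /andP[tau0 tau1] := tau01; move=> /andP[t0 t1].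
case: (ltP t tau) => [tt|tt].
  rewrite -(prob_score_itv Z_unif Z_indep (m := tau) (b := true) tau0)//;
    last first.
    by rewrite in_itv/= negb_and -ltNge (lt_trans t0).
  congr (P _); apply/seteqP; split => w /=; rewrite in_itv/=.
    move=> tw; case: (score_range tau (Z ^~ w)) => // s0.
    by move: tw; rewrite s0 leNgt t0.
  by move=> /andP[/(le_trans (ltW tt))].
rewrite -(prob_score_itv Z_unif Z_indep (m := t) (b := true) tau0)//;
    last first.
  by rewrite in_itv/= negb_and -ltNge t0.
congr (P _); apply/seteqP; split => w /=; rewrite in_itv/=.
  move=> tw; rewrite tw; case: (score_range tau (Z ^~ w)) => [->|/andP[]//].
  exact: ler01.
by case/andP.
Qed.

Context {d'} {T' : measurableType d'} {Q : probability T' R}.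
Variable X : {RV Q >-> R}.
Hypothesis XE : same_law Q P X (fun w => score tau (Z ^~ w)).

Lemma prob_gt_law m : 0 <= m ->
  Q [set w | m < X w] = (expR tau * Num.max (1 - Num.max m tau) 0)%:E.
Proof.
move=> m0; rewrite -prob_score_gt//.
have := XE (measurable_itv `]m, +oo[); rewrite /pushforward.
by rewrite /preimage; under eq_set do rewrite /= in_itv/= andbT;
  under [X in P X]eq_set do rewrite /= in_itv/= andbT.
Qed.

Lemma prob_lt_law t : 0 < t <= 1 ->
  Q [set w | X w < t] = (1 - expR tau * (1 - Num.max t tau))%:E.
Proof.
move=> t01; rewrite EFinB -prob_score_ge//.
have := XE (measurable_itv `[t, +oo[); rewrite /pushforward.
rewrite /preimage; under eq_set do rewrite /= in_itv/= andbT.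
under [X in P X]eq_set do rewrite /= in_itv/= andbT.
move=> <-; rewrite -probability_setC; last first.
  have := measurable_funPTI X (measurable_itv `[t, +oo[).
  by rewrite /preimage; under eq_set do rewrite /= in_itv/= andbT.
by congr (Q _); apply/seteqP; split => w /=; rewrite ltNge => /negP.
Qed.

End score_tails.

(** * Winning probability of one player against independent rivals *)

Section winning.
Context {R : realType} {n : nat} {d} {T : measurableType d}.
Context {Q : probability T R}.
Variable X : 'I_n -> {RV Q >-> R}.
Hypothesis X_indep : mutually_independent X.
Variable i : 'I_n.

Notation mu := (@lebesgue_measure R).

Let opponents := [seq j <- enum 'I_n | j != i].
(** Starting the maximum at 0 builds in the requirement that a winning score be positive, and also
    covers a player without rivals. *)
Let best w := \big[Num.max/0]_(j <- opponents) X j w.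

Let mmax : measurable_fun setT (fun xy : R * R => Num.max xy.1 xy.2).
Proof. exact: measurable_maxr. Qed.

Let best_mfun : {mfun T >-> R} :=
  mfun_Sub (mem_set (measurable_big_op X 0 mmax opponents)).

Let best_lt w t : 0 < t -> (best w < t) = all (fun j => X j w < t) opponents.
Proof.
move=> t0; rewrite /best; elim: opponents => [|j J IH].
  by rewrite big_nil t0.
by rewrite big_cons gt_max IH.
Qed.

Let best_ge0 w : 0 <= best w.
Proof.
rewrite /best; elim: opponents => [|j J IH]; first by rewrite big_nil.
by rewrite big_cons le_max IH orbT.
Qed.

Lemma winsE w : wins (X ^~ w) i = (best w < X i w).
Proof.
rewrite /wins; case: (ltP 0 (X i w)) => [Xi0|Xi0] /=; last first.
  by apply/esym/negbTE; rewrite -leNgt (le_trans Xi0).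
rewrite best_lt//; apply/forallP/allP => [H j|H j].
  by rewrite mem_filter => /andP[ji _]; have /implyP := H j; apply.
by apply/implyP => ji; apply: H; rewrite mem_filter ji mem_enum.
Qed.

Lemma measurable_wins : measurable [set w | wins (X ^~ w) i].
Proof.
under eq_set do rewrite winsE.
rewrite -[X in measurable X]setTI.
have := measurable_fun_ltr (measurable_funPT best_mfun)
  (measurable_funPT (X i)) measurableT (_ : measurable [set true]).
by apply.
Qed.

Lemma prob_best_lt t : 0 < t ->
  Q [set w | best w < t] = (\prod_(j < n | j != i) Q [set w | (X j w < t)%R])%E.
Proof.
move=> t0.
transitivity (Q (\big[setI/setT]_(j <- opponents) (X j @^-1` [set x | x < t]))).
  congr (Q _); rewrite -bigcap_seq.
  apply/seteqP; split => w /=; rewrite best_lt//.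
    by move/allP => H j /H.
  by move=> H; apply/allP => j /H.
rewrite X_indep.
- by rewrite /opponents big_filter big_enum_cond.
- by rewrite filter_uniq ?enum_uniq.
- move=> _; exact: (measurable_itv `]-oo, t[).
Qed.

(** By independence, integrate the tail of [X i] against the law of the best rival score. The tail
    is e^tau times a length, so exchanging the two integrations leaves e^tau times the integral of
    P(best < t) over t. *)
Lemma prob_wins (tau : R) (H : R -> R) : 0 <= tau <= 1 ->
  (forall m, 0 <= m ->
    Q [set w | m < X i w] = (expR tau * Num.max (1 - Num.max m tau) 0)%:E) ->
  (forall t, 0 < t <= 1 ->
    (\prod_(j < n | j != i) Q [set w | (X j w < t)%R])%E = (H t)%:E) ->
  measurable_fun setT H ->
  Q [set w | wins (X ^~ w) i] =
    ((expR tau)%:E * \int[mu]_(t in `[tau, 1%R]) (H t)%:E)%E.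
Proof.
move=> /andP[tau0 tau1] Xi_gt best_H mH.
pose lt_set := [set xy : R * R | xy.1 < xy.2].
have mlt : measurable lt_set.
  have mfst : measurable_fun setT (fst : R * R -> R) by [].
  have msnd : measurable_fun setT (snd : R * R -> R) by [].
  have := measurable_fun_ltr mfst msnd measurableT (_ : measurable [set true]).
  by rewrite setTI; apply.
under eq_set do rewrite winsE.
have := @big_op_product_law _ _ _ _ _ _ _ 0 mmax X_indep i opponents
  best_mfun lt_set.
move=> /= -> //; last by rewrite mem_filter eqxx/= filter_uniq// enum_uniq.
(* The section of [C] at m is ]max(m, tau), 1], whose length is the factor of e^tau in [Xi_gt]. *)
pose C := [set mt : R * R | (mt.1 < mt.2) /\ (tau < mt.2 <= 1)].
have mC : measurable C.
  have msnd : measurable_fun setT (snd : R * R -> R) by [].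
  have := measurableI _ _ mlt (msnd measurableT _ (measurable_itv `]tau, 1])).
  rewrite !setTI; congr (measurable _); apply/seteqP; split => xy;
    by rewrite /C /= in_itv.
transitivity ((expR tau)%:E * (distribution Q best_mfun \x mu) C)%E.
  rewrite /product_measure1 -ge0_integralZl//; last first.
    exact: measurable_fun_xsection.
  rewrite !ge0_integral_distribution//; last 3 first.
  - by apply: measurable_funeM; exact: measurable_fun_xsection.
  - by move=> x; rewrite mule_ge0// lee_fin expR_ge0.
  - exact: measurable_fun_xsection.
  apply: eq_integral => w _ /=.
  rewrite /distribution /pushforward.
  rewrite (_ : _ @^-1` _ = [set w' | best w < X i w']); last first.
    by apply/seteqP; split => w' /=; rewrite /xsection/= inE.
  rewrite Xi_gt// EFinM; congr (_ * _)%E.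
  rewrite (_ : xsection C _ = `]Num.max (best w) tau, 1]%classic); last first.
    apply/seteqP; split => t /=; rewrite /xsection/= inE /C/= in_itv/= gt_max.
      by case=> -> /andP[-> ->].
    by case/andP => /andP[-> ->] ->.
  rewrite lebesgue_measure_itv/= lte_fin.
  case: ltP => bt; first by rewrite max_l ?subr_ge0 ?ltW.
  by rewrite max_r ?subr_le0.
congr (_ * _)%E; rewrite product_measure12E// /product_measure2.
(* Dropping the endpoint [tau] makes every t positive, as [best_H] demands. *)
rewrite -integral_itv_obnd_cbnd; last first.
  by apply/measurable_EFinP; exact: measurable_funTS.
rewrite [RHS]integral_mkcond; apply: eq_integral => t _ /=.
rewrite patchE mem_setE in_itv/=; case: ifPn => [/andP[taut t1]|tt].
  have t0 : 0 < t by exact: le_lt_trans taut.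
  rewrite -best_H ?t0//= -prob_best_lt//.
  rewrite /distribution /pushforward; congr (Q _).
  by apply/seteqP; split => w; rewrite /ysection/= inE /C/= taut t1//; case.
rewrite (_ : ysection C t = set0) ?measure0//.
by rewrite -subset0 => m; rewrite /ysection/= inE /C/= (negbTE tt) => -[].
Qed.

End winning.

(** * Existence and uniqueness of the solution of the threshold equation *)

Section threshold.
Context {R : realType}.
Implicit Types x y a : R.

(** For x in [0, 1] this is the probability of score 0 with threshold x: one minus the mass e^x (1 -
    x) of the scores in [x, 1]. *)
Definition bust_prob x : R := 1 + expR x * (x - 1).

Lemma bust_prob0 : bust_prob 0 = 0.
Proof. by rewrite /bust_prob expR0 sub0r mul1r subrr. Qed.

(** With δ = y - x, the claim is (1 - y) e^δ < 1 - x. It follows from (1 - δ) e^δ < 1 and 1 - y = (1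
    - x)(1 - δ) - x δ. *)
Lemma bust_prob_lt x y : 0 <= x -> x < y -> y <= 1 -> bust_prob x < bust_prob y.
Proof.
move=> x0 xy y1; rewrite /bust_prob ltrD2l.
have -> : expR y = expR x * expR (y - x) by rewrite -expRD subrKC.
have e0 : 0 < expR (y - x) by exact: expR_gt0.
rewrite -mulrA ltr_pM2l ?expR_gt0//.
have : (1 + - (y - x)) * expR (y - x) < 1.
  rewrite -ltr_pdivlMr// div1r -expRN.
  by apply: expR_gt1Dx; rewrite oppr_eq0 subr_eq0 gt_eqF.
move: (expR (y - x)) e0 => e e0 h.
have x1 : 0 < 1 - x by rewrite subr_gt0 (lt_le_trans xy).
have xe : (1 - x) * ((1 + - (y - x)) * e) < (1 - x) * 1 by rewrite ltr_pM2l.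
have xye : 0 <= x * (y - x) * e by rewrite !mulr_ge0 ?subr_ge0// ltW.
nra.
Qed.

Lemma bust_prob_ge0 x : 0 <= x <= 1 -> 0 <= bust_prob x.
Proof.
move=> /andP[]; rewrite le_eqVlt => /predU1P[<-|x0 x1].
  by rewrite bust_prob0.
by rewrite -bust_prob0 ltW// bust_prob_lt.
Qed.

(** The threshold equation cleared of its denominator, with both powers on one side: this sum is
    increasing on [0, 1], so the root of [threshold_fun n x = 1] is unique. *)
Definition threshold_fun n x : R :=
  n%:R * expR x * bust_prob x ^+ n.-1 + bust_prob x ^+ n.

Lemma threshold_equationE n x : (0 < n)%N ->
  threshold_equation n x <-> 0 <= x < 1 /\ threshold_fun n x = 1.
Proof.
move=> n0; rewrite /threshold_equation /threshold_fun -/(bust_prob x).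
have ne0 : n%:R * expR x != 0 by rewrite mulf_neq0 ?gt_eqF ?ltr0n ?expR_gt0.
split=> -[x01 H]; split => //.
  by rewrite H mulrC divfK// subrK.
by apply: (mulfI ne0); rewrite mulrCA divff// mulr1 -[X in X - _]H addrK.
Qed.

Lemma threshold_fun_lt n x y : (0 < n)%N -> 0 <= x -> x < y -> y <= 1 ->
  threshold_fun n x < threshold_fun n y.
Proof.
move=> n0 x0 xy y1; have Bxy := bust_prob_lt x0 xy y1.
have Bx0 : 0 <= bust_prob x by rewrite bust_prob_ge0// x0 (le_trans (ltW xy)).
have By0 : 0 <= bust_prob y by exact: le_trans (ltW Bxy).
rewrite /threshold_fun ler_ltD//.
  rewrite ler_pM ?exprn_ge0 ?mulr_ge0 ?expR_ge0//.
    by rewrite ler_wpM2l ?ler0n// ler_expR ltW.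
  by rewrite lerXn2r ?nnegrE// ltW.
by rewrite ltrXn2r -?lt0n.
Qed.

Lemma continuous_threshold_fun n : continuous (threshold_fun n).
Proof.
have cB : continuous bust_prob.
  move=> x; apply: cvgD; first exact: cvg_cst.
  apply: cvgM; first exact: continuous_expR.
  by apply: cvgB => //; exact: cvg_cst.
have cBX k x := continuous_comp (cB x) (@exprn_continuous _ k _).
move=> x; apply: cvgD; last exact: cBX.
apply: cvgM; last exact: cBX.
by apply: cvgM; [exact: cvg_cst|exact: continuous_expR].
Qed.

Lemma unique_threshold n : (0 < n)%N ->
  exists a, unique (threshold_equation n) a.
Proof.
move=> n0.
(* For n = 1 the value is 1, by 0^0 = 1, and the root is 0 itself; for n >= 2 the value is 0. *)
have t0 : threshold_fun n 0 <= 1.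
  rewrite /threshold_fun bust_prob0 expR0 mulr1.
  by case: n n0 => // -[|n] _; rewrite !expr0n/= ?mulr1 ?mulr0 addr0 ?ler01.
have t1 : 1 < threshold_fun n 1.
  rewrite /threshold_fun /bust_prob subrr mulr0 addr0 !expr1n mulr1 ltrDr.
  by rewrite mulr_gt0 ?ltr0n ?expR_gt0.
have t01 : Num.min (threshold_fun n 0) (threshold_fun n 1) <= 1 <=
    Num.max (threshold_fun n 0) (threshold_fun n 1).
  by rewrite ge_min t0 le_max (ltW t1) orbT.
have [a] := @IVT R (threshold_fun n) 0 1 1 ler01
  (continuous_subspaceT (@continuous_threshold_fun n)) t01.
rewrite in_itv/= => /andP[a0 a1] ta.
have {}a1 : a < 1.
  rewrite lt_neqAle a1 andbT; apply/eqP => a1'.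
  by move: t1; rewrite -[X in threshold_fun n X]a1' ta ltxx.
exists a; split; first by apply/threshold_equationE => //; rewrite a0 a1.
move=> b /(threshold_equationE _ n0)[/andP[b0 b1] tb].
have [ab|ba|//] := ltgtP a b.
  have := threshold_fun_lt n0 a0 ab (ltW b1).
  by rewrite ta tb ltxx.
by have := threshold_fun_lt n0 b0 ba (ltW a1); rewrite ta tb ltxx.
Qed.

End threshold.

(** * The best reply to rivals who all use the threshold [a] *)

Section best_reply.
Context {R : realType}.
Variables (a : R) (n : nat).
Hypotheses (a01 : 0 <= a < 1) (n_gt0 : (0 < n)%N).
Notation mu := (@lebesgue_measure R).

(** For 0 < t <= 1, the probability that all n - 1 rivals score less than t; the maximum makes it
    constant for t <= a. *)
Definition rivals_cdf (t : R) : R := (1 - expR a * (1 - Num.max t a)) ^+ n.-1.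

Lemma measurable_rivals_cdf : measurable_fun setT rivals_cdf.
Proof.
apply: measurable_funX; apply: measurable_funB => //.
apply: measurable_funM => //; apply: measurable_funB => //.
exact: measurable_maxr.
Qed.

Lemma rivals_cdf_ge0 t : t <= 1 -> 0 <= rivals_cdf t.
Proof.
have /andP[a0 a1] := a01; move=> t1; apply: exprn_ge0.
have := @bust_prob_ge0 R a; rewrite a0 (ltW a1) => /(_ isT).
rewrite /bust_prob => /le_trans; apply.
by rewrite -mulrN opprB lerD2l ler_pM2l ?expR_gt0// lerD2r le_max lexx orbT.
Qed.

Lemma integral_rivals_ge tau : a <= tau <= 1 ->
  (\int[mu]_(t in `[tau, 1%R]) (rivals_cdf t)%:E =
   ((1 - (1 - expR a * (1 - tau)) ^+ n) / (n%:R * expR a))%:E)%E.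
Proof.
move=> /andP[atau tau1].
transitivity (\int[mu]_(t in `[tau, 1%R])
    ((expR a * t + (1 - expR a)) ^+ n.-1)%:E)%E.
  apply: eq_integral => t; rewrite inE/= in_itv/= => /andP[taut _].
  rewrite /rivals_cdf max_l ?(le_trans atau)//; congr (_ ^+ _)%:E; ring.
rewrite integral_affine_exp ?gt_eqF ?expR_gt0// prednK//.
rewrite mulr1 subrKC expr1n [expR a * n%:R]mulrC.
by congr ((1 - _ ^+ _) / _)%:E; ring.
Qed.

Lemma integral_rivals_le tau : 0 <= tau <= a ->
  (\int[mu]_(t in `[tau, 1%R]) (rivals_cdf t)%:E =
   (bust_prob a ^+ n.-1 * (a - tau) +
    (1 - bust_prob a ^+ n) / (n%:R * expR a))%:E)%E.
Proof.
have /andP[a0 a1] := a01; move=> /andP[tau0 taua].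
have mh D : measurable_fun D (EFin \o rivals_cdf).
  apply/measurable_EFinP; apply: measurable_funTS.
  exact: measurable_rivals_cdf.
rewrite (@itv_bndbnd_setU _ _ _ (BLeft a)) ?bnd_simp ?(ltW a1)//.
rewrite ge0_integral_setU//=; last 3 first.
- exact: mh.
- move=> t [] /=; rewrite in_itv/= lee_fin => /andP[_ t1];
    apply: rivals_cdf_ge0 => //.
  by rewrite ltW// (lt_trans t1).
- apply: lt_disjoint => x y; rewrite /= !in_itv/= => /andP[_ xa] /andP[ay _].
  exact: lt_le_trans ay.
rewrite integral_rivals_ge ?lexx ?ltW// EFinD; congr (_ + _)%E; last first.
  by rewrite /bust_prob; congr ((1 - _ ^+ _) / _)%:E; ring.
transitivity (\int[mu]_(t in `[tau, a[) (bust_prob a ^+ n.-1)%:E)%E.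
  apply: eq_integral => t; rewrite inE/= in_itv/= => /andP[_ ta].
  rewrite /rivals_cdf max_r ?ltW//; congr (_ ^+ _)%:E.
  by rewrite /bust_prob; ring.
rewrite integral_cst//= EFinM lebesgue_measure_itv/= lte_fin.
case: ltP => // ata; have -> : tau = a by apply/eqP; rewrite eq_le taua.
by rewrite subrr.
Qed.

(** A power lies above its tangent at x. In the induction, y times the tangent for one exponent
    exceeds the tangent for the next by (k + 1) x^k (y - x)^2. *)
Lemma tangent_le_exprn (x y : R) k : 0 <= x <= y ->
  x ^+ k.+1 + k.+1%:R * x ^+ k * (y - x) <= y ^+ k.+1.
Proof.
move=> /andP[x0 xy]; elim: k => [|k IH].
  by rewrite !expr1 expr0 mulr1 mul1r addrC subrK.
rewrite [leRHS]exprS; apply: le_trans (ler_wpM2l (le_trans x0 xy) IH).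
rewrite -[k.+2%:R]natr1 !exprS -subr_ge0.
rewrite [leRHS](_ : _ = k.+1%:R * x ^+ k * (y - x) ^+ 2); last by ring.
by rewrite !mulr_ge0 ?exprn_ge0 ?subr_ge0.
Qed.

Hypothesis threshold_a : threshold_fun n a = 1.

(** The threshold equation read as an identity between the integral of [rivals_cdf] over [a, 1] and
    its value at [a]. *)
Let bE : (1 - bust_prob a ^+ n) / (n%:R * expR a) = bust_prob a ^+ n.-1.
Proof.
have /(threshold_equationE _ n_gt0)[_ ->//] :
    0 <= a < 1 /\ threshold_fun n a = 1.
  by [].
Qed.

Lemma best_reply tau : 0 <= tau <= 1 ->
  ((expR tau)%:E * \int[mu]_(t in `[tau, 1%R]) (rivals_cdf t)%:E <=
   ((1 - bust_prob a ^+ n) / n%:R)%:E)%E.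
Proof.
have /andP[a0 a1] := a01; move=> /andP[tau0 tau1].
pose c := bust_prob a ^+ n.-1.
have c0 : 0 <= c by rewrite exprn_ge0// bust_prob_ge0// a0 ltW.
have -> : (1 - bust_prob a ^+ n) / n%:R = expR a * c.
  rewrite /c -bE; field.
  by rewrite pnatr_eq0 -lt0n n_gt0 gt_eqF ?expR_gt0.
suff [I -> Ic] : exists2 I : R,
    (\int[mu]_(t in `[tau, 1%R]) (rivals_cdf t)%:E)%E = I%:E &
    I <= c * (1 + (a - tau)).
  rewrite -EFinM lee_fin.
  have -> : expR a = expR tau * expR (a - tau) by rewrite -expRD subrKC.
  rewrite -mulrA ler_pM2l ?expR_gt0// (le_trans Ic)// mulrC ler_wpM2r//.
  exact: expR_ge1Dx.
(* Below [a] the bound on the integral is an equality; above [a] it comes from convexity. *)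
have [taua|atau] := leP tau a.
  eexists; first by apply: integral_rivals_le; rewrite tau0.
  by rewrite bE -/c [leRHS]mulrDr mulr1 addrC.
eexists; first by apply: integral_rivals_ge; rewrite (ltW atau).
rewrite ler_pdivrMr ?mulr_gt0 ?expR_gt0 ?ltr0n//.
(* The goal is now 1 - y^n <= c (1 + (a - tau)) n e^a. The tangent of the n-th power at
   [bust_prob a] has slope n c, and y - bust_prob a = e^a (tau - a). *)
pose y := 1 - expR a * (1 - tau).
have yE : y - bust_prob a = expR a * (tau - a) by rewrite /y /bust_prob; ring.
have ay : 0 <= bust_prob a <= y.
  apply/andP; split; first by rewrite bust_prob_ge0// a0 ltW.
  by rewrite -subr_ge0 yE mulr_ge0 ?expR_ge0// subr_ge0 ltW.
have := tangent_le_exprn n.-1 ay; rewrite prednK// -/c -/y yE.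
have : 1 - bust_prob a ^+ n = c * (n%:R * expR a).
  by rewrite /c -bE divfK// mulf_neq0 ?gt_eqF ?expR_gt0 ?ltr0n.
lra.
Qed.

Lemma best_reply_eq :
  ((expR a)%:E * \int[mu]_(t in `[a, 1%R]) (rivals_cdf t)%:E =
   ((1 - bust_prob a ^+ n) / n%:R)%:E)%E.
Proof.
have /andP[a0 a1] := a01.
rewrite integral_rivals_le ?a0 ?lexx// subrr mulr0 add0r -EFinM; congr _%:E.
by field; rewrite pnatr_eq0 -lt0n n_gt0 gt_eqF ?expR_gt0.
Qed.

End best_reply.

(** * Assembly of the symmetric equilibrium *)

Lemma prob_wins_against_threshold (R : realType) (n : nat)
    d (T : measurableType d) (P : probability T R) (Z : nat -> {RV P >-> R})
    d' (T' : measurableType d') (Q : probability T' R)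
    (X : 'I_n -> {RV Q >-> R}) (i : 'I_n) (a tau : R) :
  mutually_independent Z -> (forall k, uniform01 (Z k)) ->
  mutually_independent X -> 0 <= a <= 1 -> 0 <= tau <= 1 ->
  same_law Q P (X i) (fun w => score tau (Z ^~ w)) ->
  (forall j, j != i -> same_law Q P (X j) (fun w => score a (Z ^~ w))) ->
  Q [set w | wins (X ^~ w) i] =
    ((expR tau)%:E *
     \int[lebesgue_measure]_(t in `[tau, 1%R]) (rivals_cdf a n t)%:E)%E.
Proof.
move=> Z_indep Z_unif X_indep a01 tau01 Xi Xj; apply: prob_wins => //.
- by move=> m m0; apply: (prob_gt_law Z_unif Z_indep).
- move=> t t01.
  rewrite (eq_bigr (fun=> (1 - expR a * (1 - Num.max t a))%:E)); last first.
    by move=> j ji; apply: (prob_lt_law Z_unif Z_indep a01 (Xj j ji)).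
  rewrite prodEFin prodr_const; congr (_ ^+ _)%:E.
  by rewrite cardC1 card_ord.
- exact: measurable_rivals_cdf.
Qed.

Lemma expected_payoffE (R : realType) d (T : measurableType d)
    (P : probability T R) (n : nat) (xi : 'I_n -> R -> {RV P >-> R})
    (kappa : 'I_n -> R) (i : 'I_n) :
  expected_payoff xi kappa i = winning_probability xi kappa i.
Proof.
rewrite /expected_payoff /winning_probability -expectation_indic; last first.
  exact: (measurable_wins (fun j => xi j (kappa j))).
congr ('E_P[_])%E; apply/funext => w; rewrite /payoff indicE.
congr (_%:R); congr nat_of_bool; apply/idP/idP; rewrite inE//.
Qed.

Theorem proposition5 (R : realType) (n : nat) (n_gt0 : (0 < n)%N)
    (* the spins Z_1, Z_2, ... *)
    (d : measure_display) (T : measurableType d) (P : probability T R)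
    (Z : nat -> {RV P >-> R})
    (Z_indep : mutually_independent Z)
    (Z_unif : forall k, uniform01 (Z k))
    (* the scores of the n players as functions of their thresholds *)
    (d' : measure_display) (T' : measurableType d') (Q : probability T' R)
    (xi : 'I_n -> R -> {RV Q >-> R})
    (xi_indep : forall kappa : 'I_n -> R, (forall i, 0 <= kappa i <= 1) ->
       mutually_independent (fun i => xi i (kappa i)))
    (xi_law : forall (i : 'I_n) (tau : R), 0 <= tau <= 1 ->
       same_law Q P (xi i tau) (fun w => score tau (fun k => Z k w))) :
  exists alpha : R,
    [/\ unique (threshold_equation n) alpha,
        nash_equilibrium `[0, 1] (expected_payoff xi) (fun=> alpha) &
        forall i : 'I_n, winning_probability xi (fun=> alpha) i =
          ((1 - (1 - expR alpha + expR alpha * alpha) ^+ n) / n%:R)%:E].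
Proof.
have [a [/(threshold_equationE _ n_gt0) [a01 ta] a_uniq]] :=
  @unique_threshold R n n_gt0.
have a01' : 0 <= a <= 1 by case/andP: a01 => -> /ltW.
have win_prob (i : 'I_n) (tau : R) : 0 <= tau <= 1 ->
    winning_probability xi (deviate (fun=> a) i tau) i =
    ((expR tau)%:E *
     \int[lebesgue_measure]_(t in `[tau, 1%R]) (rivals_cdf a n t)%:E)%E.
  move=> tau01.
  apply: (@prob_wins_against_threshold _ _ _ _ _ _ _ _ _
    (fun j => xi j (deviate (fun=> a) i tau j)) i a tau Z_indep Z_unif) => //.
  - by apply: xi_indep => j; rewrite /deviate; case: ifP.
  - by rewrite /deviate eqxx; exact: xi_law.
  - by move=> j ji; rewrite /deviate (negbTE ji); exact: xi_law.
(* Staying at [a] is a trivial deviation, so [win_prob] at tau = a also yields the equilibrium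
   probability. *)
have deviate_a i : deviate (fun=> a) i a = (fun=> a) :> ('I_n -> R).
  by apply/funext => j; rewrite /deviate; case: ifP.
have win_a i : winning_probability xi (fun=> a) i =
    ((1 - bust_prob a ^+ n) / n%:R)%:E.
  by rewrite -{1}(deviate_a i) win_prob// best_reply_eq.
exists a; split.
- split=> //; exact/threshold_equationE.
- split=> [_|i tau]; rewrite /= in_itv//= => tau01.
  by rewrite !expected_payoffE win_a win_prob// best_reply.
- move=> i; rewrite win_a /bust_prob; congr ((1 - _ ^+ _) / _)%:E; ring.
Qed.
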